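(* Let $E$ be an inclusion-exclusion-like set-valued expression in $X_1,\dots,X_n$, let $\mathcal{S}$ be its characteristic set, and let $C=\{k: \exists J\in\mathcal{S} \text{ with } |J|=k\}$ be the set of cardinalities of members of $\mathcal{S}$. Let $f=\chi_C$ be the characteristic function of $C$. Then for every sequence of finite sets $\mathcal{A}=(A_1,\dots,A_n)$, $$|E(A_1,\dots,A_n)|=\sum_{k=1}^n c_k\, i_{n,k}(\mathcal{A}),\qquad\text{where } c_k=\sum_{j=1}^k(-1)^{k-j}\binom{k}{j}f(j).$$
   Context: Fix a positive integer $n$ and write $\bar n=\{1,\dots,n\}$. Set-valued expressions in the variables $X_1,\dots,X_n$ are defined recursively: $\emptyset$ is an expression; each $X_i$ is an expression; if $F,F_1,F_2$ are expressions then so are $F^c$, $F_1\cup F_2$, $F_1\cap F_2$. For a sequence of sets $\mathcal{A}=(A_1,\dots,A_n)$ the value $E(\mathcal{A})$ is defined recursively by $\emptyset(\mathcal{A})=\emptyset$, $X_i(\mathcal{A})=A_i$, $(F^c)(\mathcal{A})=(A_1\cup\dots\cup A_n)\setminus F(\mathcal{A})$, $(F_1\cup F_2)(\mathcal{A})=F_1(\mathcal{A})\cup F_2(\mathcal{A})$, $(F_1\cap F_2)(\mathcal{A})=F_1(\mathcal{A})\cap F_2(\mathcal{A})$. Expressions $E,F$ are equivalent, $E\cong F$, if $E(\mathcal{A})=F(\mathcal{A})$ for every sequence of sets $\mathcal{A}$. Finite unions/intersections of expressions are defined up to equivalence; an empty union is $\emptyset$. For $I\subseteq\bar n$ let $G_I=\bigcap_{i\in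 I}X_i\cap\bigcap_{i\in\bar n\setminus I}X_i^c$, and for $\mathcal{S}\subseteq\mathcal{P}(\bar n)$ let $F_{\mathcal{S}}=\bigcup_{I\in\mathcal{S}}G_I$. The characteristic set of $E$ is the unique $\mathcal{S}\subseteq\mathcal{P}(\bar n)\setminus\{\emptyset\}$ with $E\cong F_{\mathcal{S}}$ (such a set exists and is unique). For a sequence of finite sets $\mathcal{A}$ and $1\le k\le n$, $i_{n,k}(\mathcal{A})=\sum_{I\subseteq\bar n,|I|=k}\left|\bigcap_{i\in I}A_i\right|$. An expression $E$ is inclusion-exclusion-like if there exist real constants $c_1,\dots,c_n$ such that for every sequence of finite sets $\mathcal{A}$ one has $|E(\mathcal{A})|=\sum_{k=1}^n c_k\, i_{n,k}(\mathcal{A})$. *)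

(* Defs.v *)
From mathcomp Require Import all_boot all_order all_algebra finmap.
From mathcomp Require Import boolp classical_sets functions cardinality reals.
From mathcomp Require Import numfun.

Set Implicit Arguments.
Unset Strict Implicit.
Unset Printing Implicit Defensive.

Import Order.TTheory GRing.Theory Num.Theory.
Local Open Scope classical_set_scope.
Local Open Scope ring_scope.

(* Set-valued expressions; the variables X_1, ..., X_n are indexed by 'I_n. *)
Inductive sexpr (n : nat) : Type :=
| SEmpty : sexpr n
| SVar : 'I_n -> sexpr n
| SCompl : sexpr n -> sexpr n
| SUnion : sexpr n -> sexpr n -> sexpr n
| SInter : sexpr n -> sexpr n -> sexpr n.

Arguments SEmpty {n}.

Fixpoint svalue (n : nat) (T : Type) (A : 'I_n -> set T) (E : sexpr n) : set T :=
  match E with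
  | SEmpty => set0
  | SVar i => A i
  | SCompl F => (\bigcup_i A i) `\` svalue A F
  | SUnion F1 F2 => svalue A F1 `|` svalue A F2
  | SInter F1 F2 => svalue A F1 `&` svalue A F2
  end.

Definition sequiv (n : nat) (E F : sexpr n) : Prop :=
  forall (T : Type) (A : 'I_n -> set T), svalue A E = svalue A F.

(* The full expression, whose value is the union of the A_i, serves as the
   empty intersection: it is a neutral element of SInter up to sequiv. *)
Definition SFull (n : nat) : sexpr n := SCompl SEmpty.
Arguments SFull {n}.

Definition GI (n : nat) (I : {set 'I_n}) : sexpr n :=
  SInter (\big[@SInter n/SFull]_(i in I) SVar i)
         (\big[@SInter n/SFull]_(i in ~: I) SCompl (SVar i)).

Definition FS (n : nat) (S : {set {set 'I_n}}) : sexpr n :=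
  \big[@SUnion n/SEmpty]_(I in S) GI I.

Definition is_charset (n : nat) (E : sexpr n) (S : {set {set 'I_n}}) : Prop :=
  finset.set0 \notin S /\ sequiv E (FS S).

(* [fset_set A] is the finite set with the same elements as A when A is finite
   (and the empty one otherwise). *)
Definition ncard (T : choiceType) (A : set T) : nat := #|` fset_set A|.

(* Used for 1 <= k only, so that the intersections are over nonempty I. *)
Definition ink (n : nat) (T : choiceType) (A : 'I_n -> set T) (k : nat) : nat :=
  (\sum_(I : {set 'I_n} | #|I| == k) ncard (\bigcap_(i in [set` I]) A i))%N.

(* Only the values c 1, ..., c n matter. *)
Definition ie_like (R : realType) (n : nat) (E : sexpr n) : Prop :=
  exists c : nat -> R,
    forall (T : choiceType) (A : 'I_n -> set T),
      (forall i, finite_set (A i)) ->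
      (ncard (svalue A E))%:R = \sum_(1 <= k < n.+1) c k * (ink A k)%:R.

Definition cardset (n : nat) (S : {set {set 'I_n}}) : set nat :=
  [set k | exists2 J : {set 'I_n}, J \in S & #|J| = k].

Definition ie_coef (R : realType) (f : nat -> R) (k : nat) : R :=
  \sum_(1 <= j < k.+1) (-1) ^+ (k - j) * 'C(k, j)%:R * f j.

(* Main.v *)
(* For a nonempty J, evaluate the inclusion-exclusion-like identity, with
   coefficients c_k, at the sets A_i = {tt} if i is in J and A_i = set0
   otherwise: the left-hand side is 1 or 0 according to whether J is in S, and
   i_{n,k} is 'C(#|J|, k). Hence J being in S depends on #|J| only, and
   f(j) = sum_k c_k 'C(j, k) for 1 <= j <= n; binomial inversion gives c. *)
Require Import Defs.
From mathcomp Require Import all_boot all_order all_algebra finmap.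
From mathcomp Require Import boolp classical_sets functions cardinality reals.
From mathcomp Require Import numfun.

Set Implicit Arguments.
Unset Strict Implicit.
Unset Printing Implicit Defensive.

Import Order.TTheory GRing.Theory Num.Theory.
Local Open Scope classical_set_scope.
Local Open Scope ring_scope.

(** The empty intersection is [SFull], whose value is the union of the [A i], not all of [T]; hence
    the assumption on [x]. *)
Lemma svalue_bigI (n : nat) (T : Type) (A : 'I_n -> set T) (x : T)
    (I : Type) (r : seq I) (P : pred I) (F : I -> sexpr n) :
  (\bigcup_i A i) x -> (forall i, P i -> svalue A (F i) x) ->
  svalue A (\big[@SInter n/SFull]_(i <- r | P i) F i) x.
Proof.
move=> Ux Fx; apply: (big_ind (fun E => svalue A E x)) => //.
by split=> // -[].
Qed.

Lemma svalue_bigI_sub (n : nat) (T : Type) (A : 'I_n -> set T)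
    (I : eqType) (r : seq I) (P : pred I) (F : I -> sexpr n) (i : I) :
  i \in r -> P i ->
  svalue A (\big[@SInter n/SFull]_(i <- r | P i) F i) `<=` svalue A (F i).
Proof.
elim: r => // j r IHr; rewrite inE => /predU1P[<- Pi x|ri Pi x].
  by rewrite big_cons Pi => -[].
by rewrite big_cons; case: ifP => _ => [[_]|]; apply: IHr.
Qed.

Lemma svalue_bigU (n : nat) (T : Type) (A : 'I_n -> set T) (x : T)
    (I : eqType) (r : seq I) (P : pred I) (F : I -> sexpr n) :
  svalue A (\big[@SUnion n/SEmpty]_(i <- r | P i) F i) x <->
  exists i, [/\ i \in r, P i & svalue A (F i) x].
Proof.
elim: r => [|j r IHr]; first by rewrite big_nil; split=> [|[? []]].
rewrite big_cons; case: ifP => Pj; split.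
- case=> [Fx|/IHr[i [ri Pi Fx]]]; first by exists j; rewrite mem_head.
  by exists i; rewrite inE ri orbT.
- case=> i [/[!inE] /predU1P[->|ri] Pi Fx]; [by left | right].
  by apply/IHr; exists i.
- by case/IHr=> i [ri Pi Fx]; exists i; rewrite inE ri orbT.
- case=> i [/[!inE] /predU1P[->|ri] Pi Fx]; first by rewrite Pj in Pi.
  by apply/IHr; exists i.
Qed.

(** The values of the [GI I] are the cells of the Venn diagram of the [A i]: a point of the union
    lies in just one of them, indexed by its membership pattern. *)
Lemma svalue_GI (n : nat) (T : Type) (A : 'I_n -> set T) (x : T)
    (I : {set 'I_n}) :
  (\bigcup_i A i) x ->
  svalue A (GI I) x <-> I = [set i | `[< A i x >]]%SET.
Proof.
move=> Ux; split=> [[Ix CIx]|->].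
  apply/setP=> i; rewrite inE; apply/idP/asboolP => [iI|Aix].
    exact: svalue_bigI_sub (mem_index_enum i) iI _ Ix.
  apply/negPn/negP => iI; have iCI : i \in (~: I)%SET by rewrite inE.
  by case: (svalue_bigI_sub (mem_index_enum i) iCI CIx).
split; apply: svalue_bigI => // i; rewrite ?finset.in_setC finset.in_set => /asboolP //.
Qed.

Lemma svalue_FS (n : nat) (T : Type) (A : 'I_n -> set T) (x : T)
    (S : {set {set 'I_n}}) :
  (\bigcup_i A i) x ->
  svalue A (FS S) x <-> ([set i | `[< A i x >]]%SET \in S).
Proof.
move=> Ux; split=> [/svalue_bigU[I [_ IS /(svalue_GI _ Ux) <-]] //|IS].
apply/svalue_bigU; exists [set i | `[< A i x >]]%SET.
split=> //; exact/svalue_GI.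
Qed.

Lemma ncard_unit (D : set unit) : ncard D = `[< D tt >].
Proof.
rewrite /ncard; case: asboolP => Dtt.
  have -> : D = [set tt] by apply/seteqP; split=> [[]|[]].
  by rewrite fset_set1 cardfs1.
have -> : D = set0 by apply/seteqP; split=> [[]|[]].
by rewrite fset_set0 cardfs0.
Qed.

Definition indic_family (n : nat) (J : {set 'I_n}) (i : 'I_n) : set unit :=
  [set _ | i \in J].

(** The intersection over [I] contains [tt] exactly when [I] is a subset of [J], so the sum counts
    the subsets of [J] with [k] elements. *)
Lemma ink_indic_family (n : nat) (J : {set 'I_n}) (k : nat) :
  ink (indic_family J) k = 'C(#|J|, k).
Proof.
rewrite -cards_draws -sum1dep_card /ink.
under [LHS]eq_bigr do rewrite ncard_unit.
rewrite [RHS]big_mkcondl [RHS]big_mkcond [LHS]big_mkcond /=.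
apply: eq_bigr => I _; case: ifP => // _.
suff -> : `[< (\bigcap_(i in [set` I]) indic_family J i) tt >] = (I \subset J).
  by case: (_ \subset _).
exact/asboolP/fintype.subsetP.
Qed.

(** As [J] is nonempty, [tt] lies in the union of the family, and its membership pattern is [J]
    itself. *)
Lemma ncard_indic_family (n : nat) (E : sexpr n) (S : {set {set 'I_n}})
    (J : {set 'I_n}) :
  sequiv E (FS S) -> (0 < #|J|)%N ->
  ncard (svalue (indic_family J) E) = (J \in S).
Proof.
move=> -> /card_gt0P[i iJ]; rewrite ncard_unit; congr (nat_of_bool _).
have Ux : (\bigcup_i indic_family J i) tt by exists i.
have {2}-> : J = [set i | `[< indic_family J i tt >]]%SET.
  by apply/setP=> j; rewrite inE asboolb.
by apply/asboolP/idP => /(svalue_FS _ Ux).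
Qed.

(* The coefficient of 'X^i in ((1 + 'X) - 1) ^+ k. *)
Lemma sum_alt_bin_bin (R : comNzRingType) (k i : nat) :
  \sum_(j < k.+1) (-1) ^+ (k - j) * 'C(k, j)%:R * 'C(j, i)%:R
    = (i == k)%:R :> R.
Proof.
have coef1DX j : ((1 + 'X) ^+ j)`_i = 'C(j, i)%:R :> R.
  rewrite exprDn coef_sum; under eq_bigr do
    rewrite expr1n mul1r coefMn coefXn.
  case: (ltnP i j.+1) => ij.
    rewrite (bigD1 (Ordinal ij)) //= eqxx big1 ?addr0 // => l.
    by rewrite -val_eqE /= eq_sym => /negPf->; rewrite mul0rn.
  rewrite bin_small // big1 // => l _.
  by rewrite gtn_eqF ?mul0rn // (leq_trans (ltn_ord l)).
(* ['X ^+ k] is expanded by the binomial theorem, with ['X] written as [-1 + (1 + 'X)]. *)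
rewrite -(coefXn R k i) -['X](addKr 1) exprDn coef_sum; apply: eq_bigr => j _.
by rewrite coefMn -(rmorphN1 (@polyC R)) -rmorphXn coefCM coef1DX
  -mulrA mulr_natl mulrnAr.
Qed.

(** Binomial inversion: once the two sums are exchanged, the inner alternating sum is a Kronecker
    delta and only [i = k] survives. *)
Lemma ie_coef_bin (R : realType) (n : nat) (c f : nat -> R) (k : nat) :
  (0 < k <= n)%N ->
  (forall j, (0 < j <= n)%N ->
     f j = \sum_(1 <= i < n.+1) c i * 'C(j, i)%:R) ->
  ie_coef f k = c k.
Proof.
move=> /andP[k_gt0 k_le_n] fE; rewrite /ie_coef.
transitivity (\sum_(1 <= j < k.+1) \sum_(1 <= i < n.+1)
    c i * ((-1) ^+ (k - j) * 'C(k, j)%:R * 'C(j, i)%:R)).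
  apply: eq_big_nat => j /andP[j_gt0 j_le_k].
  rewrite fE ?j_gt0 ?(leq_trans _ k_le_n) // mulr_sumr.
  by apply: eq_bigr => i _; rewrite mulrCA.
rewrite exchange_big_nat.
rewrite (bigD1_seq k) /= ?iota_uniq ?mem_index_iota ?k_gt0 //.
have sumE i : (0 < i)%N -> \sum_(1 <= j < k.+1)
    c i * ((-1) ^+ (k - j) * 'C(k, j)%:R * 'C(j, i)%:R) = c i * (i == k)%:R.
  move=> i_gt0; rewrite -mulr_sumr -sum_alt_bin_bin -(big_mkord xpredT
    (fun j => (-1) ^+ (k - j) * 'C(k, j)%:R * 'C(j, i)%:R)).
  (* The alternating sum starts at 0, but its term [j = 0] vanishes since ['C(0, i) = 0] for
     positive [i]. *)
  by rewrite [in RHS]big_ltn // bin0n gtn_eqF // mulr0 add0r.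
rewrite sumE // eqxx mulr1 big_seq_cond big1 ?addr0 // => i.
rewrite mem_index_iota => /andP[/andP[i_gt0 _] /negPf i_neq_k].
by rewrite sumE // i_neq_k mulr0.
Qed.

Theorem theorem3p11 (R : realType) (n : nat) (n_gt0 : (0 < n)%N)
    (E : sexpr n) (E_ie : ie_like R E)
    (S : {set {set 'I_n}}) (E_S : is_charset E S)
    (T : choiceType) (A : 'I_n -> set T) (A_fin : forall i, finite_set (A i)) :
  (ncard (svalue A E))%:R =
    \sum_(1 <= k < n.+1) ie_coef (\1_(cardset S) : nat -> R) k * (ink A k)%:R.
Proof.
case: E_ie => c cE; rewrite cE //; apply: eq_big_nat => k k_range.
congr (_ * _); apply/esym/(ie_coef_bin k_range) => j /andP[j_gt0 j_le_n].
have SE (J : {set 'I_n}) : #|J| = j ->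
    (J \in S)%:R = \sum_(1 <= i < n.+1) c i * 'C(j, i)%:R :> R.
  move=> Jj; rewrite -(ncard_indic_family E_S.2) ?Jj // cE => [|i].
    by apply: eq_bigr => i _; rewrite ink_indic_family Jj.
  exact: finite_finset.
(* Since [j <= n], there are ['C(n, j) > 0] subsets of size [j]; any one of them serves to test
   whether [j] is in [cardset S]. *)
have [J Jj] : exists J : {set 'I_n}, #|J| = j.
  have : (0 < #|[set J : {set 'I_n} | #|J| == j]%SET|)%N.
    by rewrite card_draws card_ord bin_gt0.
  by case/card_gt0P=> J /[!inE] /eqP; exists J.
rewrite -(SE J Jj) indicE; congr (_%:R); congr (nat_of_bool _).
apply/idP/idP => [|JS]; rewrite inE; last by exists J.
(* By [SE], sets of equal size [j] give the same value, so [J'] in [S] and [J] outside [S] would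
   yield 1 = 0 in [R]. *)
case=> J' J'S J'j; move: (SE J' J'j); rewrite J'S -(SE J Jj).
by case: (J \in S) => // /eqP; rewrite oner_eq0.
Qed.
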